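(* Let $\mathbf{x}_1,\dots,\mathbf{x}_N\in\mathbb{R}^K$ be nonzero, let $\mathbf{T}$ be a real symmetric positive definite $K\times K$ matrix, and let $\alpha_0>0$. If the equation $$\boldsymbol{\Sigma}=\frac{1}{1+\alpha_0}\frac KN\sum_{i=1}^N\frac{\mathbf{x}_i\mathbf{x}_i^T}{\mathbf{x}_i^T\boldsymbol{\Sigma}^{-1}\mathbf{x}_i}+\frac{\alpha_0}{1+\alpha_0}\frac{K\mathbf{T}}{\mathrm{Tr}(\boldsymbol{\Sigma}^{-1}\mathbf{T})}$$ admits a solution $\boldsymbol{\Sigma}\in\mathbb{S}_{++}^K$, then for every proper subspace $S\subseteq\mathbb{R}^K$, $$P_N(S)<\frac{(1+\alpha_0)\dim(S)}{K}.$$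
   Context: $\mathbb{S}_{++}^K$ is the set of real symmetric positive definite $K\times K$ matrices. $P_N(S)=\frac1N\sum_{i=1}^N 1_{\{\mathbf{x}_i\in S\}}$ is the proportion of samples lying in $S$. ''Proper subspace'' means a linear subspace $S$ with $1\le\dim S\le K-1$. *)

(* Defs.v *)
From HB Require Import structures.
From mathcomp Require Import all_boot all_order all_algebra.
From mathcomp Require Import reals.

Set Implicit Arguments.
Unset Strict Implicit.
Unset Printing Implicit Defensive.

Import Order.TTheory GRing.Theory Num.Theory.
Local Open Scope ring_scope.

(* The scalar x^T A x, read off as the only entry of a 1 x 1 matrix. *)
Definition quad (R : realType) (K : nat) (A : 'M[R]_K) (x : 'cV[R]_K) : R :=
  (x^T *m A *m x) 0 0.

Definition sym_posdef (R : realType) (K : nat) (A : 'M[R]_K) : Prop :=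
  A^T = A /\ forall v : 'cV[R]_K, v != 0 -> 0 < quad A v.

Definition sample_prop (R : realType) (K N : nat) (x : 'I_N -> 'cV[R]_K)
    (S : {vspace 'cV[R]_K}) : R :=
  N%:R^-1 * \sum_(i < N) (x i \in S)%:R.

(* [invmx Sigma] is the inverse of [Sigma] only when [Sigma] is invertible
   (otherwise it is [Sigma] itself), so this equation is meant to be used
   together with [sym_posdef Sigma]. *)
Definition scatter_equation (R : realType) (K N : nat)
    (x : 'I_N -> 'cV[R]_K) (T : 'M[R]_K) (alpha0 : R) (Sigma : 'M[R]_K) : Prop :=
  Sigma =
    (1 / (1 + alpha0) * (K%:R / N%:R)) *:
      (\sum_(i < N) (quad (invmx Sigma) (x i))^-1 *: (x i *m (x i)^T))
    + (alpha0 / (1 + alpha0)) *: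
        ((\tr (invmx Sigma *m T))^-1 *: (K%:R *: T)).

(* Main.v *)
(* Write A = Sigma^-1 and let U be a matrix whose columns form an
   A-orthonormal basis of S.  Pair the equation with the positive
   semidefinite matrix Q = A U U^T A, i.e. multiply by Q and take traces.  The
   left-hand side gives dim S; the i-th sample contributes the ratio
   x_i^T Q x_i / x_i^T A x_i, which is nonnegative, and equals 1 when x_i is in
   S; and the T term contributes a positive amount.  Dropping the samples
   outside S gives the bound. *)
Require Import Defs.
From HB Require Import structures.
From mathcomp Require Import all_boot all_order all_algebra.
From mathcomp Require Import reals.
From mathcomp Require Import ring.

Set Implicit Arguments.
Unset Strict Implicit.
Unset Printing Implicit Defensive.

Import Order.TTheory GRing.Theory Num.Theory.
Local Open Scope ring_scope.

Lemma quad_mulmx (R : realType) (m n : nat) (A : 'M[R]_m) (B : 'M[R]_(m, n))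
    (v : 'cV[R]_n) :
  quad A (B *m v) = quad (B^T *m A *m B) v.
Proof. by rewrite /quad trmx_mul !mulmxA. Qed.

Lemma quad_gram (R : realType) (m n : nat) (B : 'M[R]_(m, n)) (v : 'cV[R]_n) :
  quad (B^T *m B) v = \sum_i (B *m v) i 0 ^+ 2.
Proof.
rewrite /quad mulmxA -trmx_mul -mulmxA mxE.
by apply: eq_bigr => i _; rewrite !mxE expr2.
Qed.

Lemma quad_gram_ge0 (R : realType) (m n : nat) (B : 'M[R]_(m, n))
    (v : 'cV[R]_n) :
  0 <= quad (B^T *m B) v.
Proof. by rewrite quad_gram sumr_ge0 // => i _; rewrite sqr_ge0. Qed.

Lemma mxtrace_outer (R : realType) (n : nat) (A : 'M[R]_n) (v : 'cV[R]_n) :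
  \tr (A *m (v *m v^T)) = quad A v.
Proof. by rewrite mulmxA mxtrace_mulC mulmxA /mxtrace big_ord1. Qed.

Lemma congr_diag (R : realType) (m n : nat) (A : 'M[R]_m) (B : 'M[R]_(m, n))
    (j : 'I_n) :
  (B^T *m A *m B) j j = quad A (col j B).
Proof.
rewrite /quad !mxE; apply: eq_bigr => i _.
by rewrite !mxE; congr (_ * _); apply: eq_bigr => k _; rewrite !mxE.
Qed.

(** The diagonal entries of [C^T *m T *m C] are the values of [quad T] at the columns of [C]. The
    role of [M] is to certify that no column vanishes: a zero column would put a 0 on the diagonal
    of [C^T *m M *m C = 1%:M]. *)
Lemma mxtrace_congr_gt0 (R : realType) (m n : nat) (M T : 'M[R]_m)
    (C : 'M[R]_(m, n)) :
  (0 < n)%N -> sym_posdef T -> C^T *m M *m C = 1%:M ->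
  0 < \tr (C^T *m T *m C).
Proof.
move=> n_gt0 [_ T_pos] CMC.
have diag_gt0 j : 0 < (C^T *m T *m C) j j.
  rewrite congr_diag; apply: T_pos; apply/eqP => C0.
  have := congr_diag M C j; rewrite CMC C0 /quad mulmx0 !mxE eqxx.
  by move/eqP; rewrite oner_eq0.
rewrite /mxtrace (bigD1 (Ordinal n_gt0)) //= ltr_wpDr //.
by rewrite sumr_ge0 // => j _; rewrite ltW.
Qed.

Lemma sym_posdef_unitmx (R : realType) (n : nat) (A : 'M[R]_n) :
  sym_posdef A -> A \in unitmx.
Proof.
move=> [A_sym A_pos]; rewrite -row_free_unit -kermx_eq0.
apply/eqP/row_matrixP => i; rewrite row0.
set r := row i _; apply/eqP; case: (eqVneq r 0) => // r0.
have rA : r *m A = 0 by apply/sub_kermxP; rewrite row_sub.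
have := A_pos r^T; rewrite trmx_eq0 => /(_ r0).
by rewrite /quad trmxK rA mul0mx mxE ltxx.
Qed.

Lemma sym_posdef_inv (R : realType) (n : nat) (A : 'M[R]_n) :
  sym_posdef A -> sym_posdef (invmx A).
Proof.
move=> A_pd; have A_unit := sym_posdef_unitmx A_pd.
case: A_pd => A_sym A_pos; have iA_sym : (invmx A)^T = invmx A.
  by rewrite trmx_inv A_sym.
split=> // v v0.
have := A_pos (invmx A *m v); rewrite quad_mulmx iA_sym mulVmx // mul1mx.
apply; apply: contra_neq v0 => iAv.
by rewrite -[v]mul1mx -(mulmxV A_unit) -mulmxA iAv mulmx0.
Qed.

Lemma sym_posdef_congr (R : realType) (m n : nat) (A : 'M[R]_m)
    (B : 'M[R]_(m, n)) :
  sym_posdef A -> (forall v : 'cV_n, v != 0 -> B *m v != 0) ->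
  sym_posdef (B^T *m A *m B).
Proof.
move=> [A_sym A_pos] B_inj; split; first by rewrite !trmx_mul trmxK A_sym mulmxA.
by move=> v v0; rewrite -quad_mulmx A_pos ?B_inj.
Qed.

(* Gram-Schmidt as an induction on Schur complements: with
   A = [a, b; b^T, D], V is obtained from D - a^-1 b^T b. *)
Lemma sym_posdef_orthonormal (R : realType) (n : nat) (A : 'M[R]_n) :
  sym_posdef A -> exists U : 'M[R]_n, U^T *m A *m U = 1%:M.
Proof.
elim: n A => [|n IHn] A; first by exists 0; apply/matrixP => -[].
rewrite -[n.+1]/(1 + n)%N in A * => -[A_sym A_pos].
pose a := ulsubmx A 0 0; pose b := ursubmx A; pose D := drsubmx A.
have A_block : A = block_mx a%:M b b^T D.
  rewrite -[LHS]submxK -[in dlsubmx A]A_sym trmx_ursub -/b.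
  by rewrite [ulsubmx A]mx11_scalar.
have D_sym : D^T = D by rewrite /D -[in RHS]A_sym trmx_drsub.
have a_gt0 : 0 < a.
  have := A_pos (col_mx 1%:M 0); rewrite /quad A_block tr_col_mx.
  rewrite mul_row_block mul_row_col !trmx0 trmx1 !mul0mx !mulmx0 !addr0.
  rewrite mul1mx mulmx1 mxE eqxx mulr1n; apply.
  by rewrite col_mx_eq0 oner_eq0.
have a_neq0 : a != 0 by rewrite gt_eqF.
pose D' := D - a^-1 *: (b^T *m b).
have D'_pd : sym_posdef D'.
  split; first by rewrite /D' linearB linearZ /= trmx_mul trmxK D_sym.
  (* This [u] solves [a u + b w = 0], so the first block of [(u^T, w^T) A] vanishes and [quad A] at
     [(u, w)] reduces to [quad D' w]. *)
  move=> w w0; set u := - a^-1 *: (b *m w).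
  have uT : u^T = - a^-1 *: (w^T *m b^T) by rewrite linearZ /= trmx_mul.
  have := A_pos (col_mx u w); rewrite col_mx_eq0 (negPf w0) andbF => /(_ isT).
  rewrite /quad A_block tr_col_mx mul_row_block mul_row_col.
  have -> : u^T *m a%:M + w^T *m b^T = 0.
    by rewrite mul_mx_scalar uT scalerA mulrN mulfV // scaleN1r addNr.
  have -> : u^T *m b + w^T *m D = w^T *m D'.
    by rewrite uT -scalemxAl mulmxBr -scalemxAr scaleNr addrC mulmxA.
  by rewrite mul0mx add0r.
have [V VDV] := IHn D' D'_pd.
pose s := Num.sqrt a.
have s_neq0 : s != 0 by rewrite sqrtr_eq0 -ltNge.
have s2 : s * s = a by rewrite -expr2 sqr_sqrtr ?ltW.
(* The first basis vector is scaled to [A]-length 1. Each column [w] of [V] is lifted to [(u, w)]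
   with [u] as above, which makes it [A]-orthogonal to the first vector and turns [A] into [D']. *)
exists (block_mx (s^-1)%:M (- a^-1 *: (b *m V)) 0 V).
have AU : block_mx a%:M b b^T D *m
    block_mx (s^-1)%:M (- a^-1 *: (b *m V)) 0 V =
    block_mx s%:M 0 (s^-1 *: b^T) (D' *m V).
  rewrite mulmx_block !mulmx0 !addr0; congr block_mx.
  - by rewrite -scalar_mxM -s2 mulfK.
  - by rewrite mul_scalar_mx scalerA mulrN mulfV // scaleN1r addNr.
  - by rewrite mul_mx_scalar.
  - by rewrite mulmxBl -scalemxAl -scalemxAr scaleNr addrC mulmxA.
rewrite A_block -mulmxA AU tr_block_mx mulmx_block trmx0 !mul0mx !mulmx0.
rewrite !addr0 !add0r tr_scalar_mx linearZ /= trmx_mul scalar_mx_block.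
congr block_mx.
- by rewrite -scalar_mxM mulVf.
- rewrite mul_mx_scalar scalerA -scalemxAr -scalerDl -s2 invfM.
  by rewrite mulrN mulrCA mulfV // mulr1 addNr scale0r.
- by rewrite mulmxA VDV.
Qed.

Lemma subspace_matrix (R : realType) (K : nat) (S : {vspace 'cV[R]_K}) :
  exists B : 'M[R]_(K, \dim S),
    (forall v : 'cV_(\dim S), v != 0 -> B *m v != 0) /\
    (forall x, x \in S -> exists v, x = B *m v).
Proof.
pose B := \matrix_(i < K, j < \dim S) ((vbasis S)`_j : 'cV[R]_K) i 0.
have BE (v : 'cV_(\dim S)) : B *m v = \sum_j v j 0 *: (vbasis S)`_j.
  apply/colP => i; rewrite mxE summxE; apply: eq_bigr => j _.
  by rewrite !mxE mulrC.
exists B; split=> [v|y yS].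
  apply: contra_neq; rewrite BE => Bv.
  have /freeP/(_ _ Bv) v0 := basis_free (vbasisP S).
  by apply/colP => j; rewrite v0 mxE.
exists (\col_j coord (vbasis S) j y); rewrite BE [LHS](coord_vbasis yS).
by apply: eq_bigr => j _; rewrite mxE.
Qed.

Lemma subspace_orthonormal (R : realType) (K : nat) (A : 'M[R]_K)
    (S : {vspace 'cV[R]_K}) :
  sym_posdef A ->
  exists U : 'M[R]_(K, \dim S),
    U^T *m A *m U = 1%:M /\ (forall x, x \in S -> exists v, x = U *m v).
Proof.
move=> A_pd; have [B [B_inj B_span]] := subspace_matrix S.
have [V VGV] := sym_posdef_orthonormal (sym_posdef_congr A_pd B_inj).
exists (B *m V); split; first by rewrite trmx_mul -VGV !mulmxA.
(* Since [V^T G V = 1] for the Gram matrix [G = B^T A B], the square matrix [V^T G] is the inverse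
   of [V]; it converts coordinates along [B] into coordinates along [B *m V]. *)
move=> y /B_span [v ->]; exists (V^T *m (B^T *m A *m B) *m v).
by rewrite [RHS]mulmxA -(mulmxA B V) (mulmx1C VGV) mulmx1.
Qed.

Theorem proposition9 (R : realType) (K N : nat) (N_gt0 : (0 < N)%N)
    (x : 'I_N -> 'cV[R]_K) (x_neq0 : forall i, x i != 0)
    (T : 'M[R]_K) (T_posdef : sym_posdef T)
    (alpha0 : R) (alpha0_gt0 : 0 < alpha0) :
  (exists Sigma : 'M[R]_K,
     sym_posdef Sigma /\ scatter_equation x T alpha0 Sigma) ->
  forall S : {vspace 'cV[R]_K},
    (1 <= \dim S)%N -> (\dim S <= K - 1)%N ->
    sample_prop x S < (1 + alpha0) * (\dim S)%:R / K%:R.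
Proof.
move=> [Sigma [Sigma_pd Sigma_eq]] S S_gt0 S_ltK.
(* Even with truncated subtraction, [1 <= K - 1] forces [1 < K]. *)
have K_gt0 : (0 < K)%N by have := leq_trans S_gt0 S_ltK; rewrite subn_gt0 => /ltnW.
have Sigma_unit := sym_posdef_unitmx Sigma_pd.
have A_pd := sym_posdef_inv Sigma_pd.
set A := invmx Sigma in A_pd *; have [A_sym A_pos] := A_pd.
have trAT_gt0 : 0 < \tr (A *m T).
  have [V VSV] := sym_posdef_orthonormal Sigma_pd.
  (* [V^T Sigma V = 1] makes [V V^T] an inverse of [Sigma], hence [\tr (A *m T)] is the trace of
     [V^T T V]. *)
  have -> : A = V *m V^T.
    rewrite -[RHS](mulmxK Sigma_unit) -[V *m V^T *m _]mulmxA.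
    by rewrite (mulmx1C VSV) mul1mx.
  by rewrite -mulmxA mxtrace_mulC (mxtrace_congr_gt0 K_gt0 T_posdef VSV).
have [U [UAU U_span]] := subspace_orthonormal S A_pd.
(* The Gram form makes [quad Q] visibly nonnegative; [QE] gives the form suited to computing
   traces. *)
pose Q := (U^T *m A)^T *m (U^T *m A).
have QE : Q = A *m U *m (U^T *m A) by rewrite /Q trmx_mul trmxK A_sym.
have trQSigma : \tr (Q *m Sigma) = (\dim S)%:R.
  by rewrite QE -!mulmxA mulVmx // mulmx1 mulmxA mxtrace_mulC mulmxA UAU mxtrace1.
have trQT_gt0 : 0 < \tr (Q *m T).
  (* The columns of [A *m U] are orthonormal for [Sigma], hence nonzero, and [\tr (Q *m T)] is the
     trace of [T] congruenced by [A *m U]. *)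
  have AUSAU : (A *m U)^T *m Sigma *m (A *m U) = 1%:M.
    by rewrite trmx_mul A_sym -UAU !mulmxA mulmxKV.
  have := mxtrace_congr_gt0 S_gt0 T_posdef AUSAU.
  rewrite trmx_mul A_sym QE -[A *m U *m _ *m T]mulmxA.
  by rewrite [in X in _ -> X]mxtrace_mulC.
have quadQ_in y : y \in S -> quad Q y = quad A y.
  move=> /U_span [v ->]; rewrite !quad_mulmx; congr (quad _ v).
  (* In the coordinates [v], both forms become the identity. *)
  by rewrite QE !mulmxA UAU mul1mx UAU.
have ratio_ge i : (x i \in S)%:R <= (quad A (x i))^-1 * quad Q (x i).
  have qA := A_pos _ (x_neq0 i).
  case: (boolP (x i \in S)) => [/quadQ_in ->|_]; first by rewrite mulVf ?gt_eqF.
  by rewrite mulr_ge0 ?quad_gram_ge0 // invr_ge0 ltW.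
have := congr1 (fun M => \tr (Q *m M)) Sigma_eq; rewrite /= -/A trQSigma.
rewrite mulmxDr mxtraceD -!scalemxAr !mxtraceZ mulmx_sumr raddf_sum /=.
under eq_bigr do rewrite -scalemxAr mxtraceZ mxtrace_outer.
move=> trace_eq; rewrite {}trace_eq /sample_prop.
set s := \sum_(i < N) (x i \in S)%:R; set q := \sum_(i < N) _.
have s_le : s <= q by exact: ler_sum.
have [a1 N1 K1] : [/\ 0 < 1 + alpha0, 0 < N%:R :> R & 0 < K%:R :> R].
  by rewrite addr_gt0 // !ltr0n.
set t := \tr (A *m T) in trAT_gt0 *; set u := \tr (Q *m T) in trQT_gt0 *.
(* With [\dim S] replaced by the traced right-hand side, the factors [1 + alpha0] and [K] cancel.
   What remains beyond [q / N] is [alpha0 * (u / t)], whose positivity makes the inequality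
   strict. *)
have -> : (1 + alpha0) *
    (1 / (1 + alpha0) * (K%:R / N%:R) * q +
     alpha0 / (1 + alpha0) * (t^-1 * (K%:R * u))) / K%:R =
    N%:R^-1 * q + alpha0 * (u / t).
  by field; rewrite !gt_eqF.
by rewrite ltr_pwDr ?mulr_gt0 ?invr_gt0 // ler_wpM2l // invr_ge0 ltW.
Qed.
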